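(* Let $2<q<\infty$. For $\epsilon>0$ let $$u_\epsilon(t) := 1 + \epsilon \cos(2\pi t) + \epsilon^2\, \frac{q-1}{12}\cos(4\pi t), \qquad t\in\mathbb{R}/\mathbb{Z}.$$ Then $$ \lim_{\epsilon\to 0^+} \frac{\| u_\epsilon\|^2 \left( \|u_\epsilon\|^2 - S\|u_\epsilon\|_q^2\right)}{\| u_\epsilon -\overline{u_\epsilon}\|^4} = \frac{(q+2)(q-2)}{12\,(q-1)} \,. $$ In particular, the following hold. (i) In the statement ''for every sequence $(u_n)\subset H^1(\mathbb{R}/\mathbb{Z})$ of nonconstant functions with $\|u_n\|^2=S$ and $\|u_n\|_q\to 1$ one has $\liminf_{n\to\infty} \frac{\| u_n\|^2 ( \|u_n\|^2 - S\|u_n\|_q^2)}{\| u_n -\overline{u_n}\|^4} \geq \frac{(q+2)(q-2)}{12(q-1)}$'', the constant on the right side cannot be replaced by a larger one. (ii) The power four is best possible: for any $\alpha<4$ there is no constant $c>0$ such that $\|u\|^2 - S\|u\|_q^2 \geq c\, \|u\|^{2-\alpha}\,\|u-\overline u\|^{\alpha}$ for all nonconstant $u\in H^1(\mathbb{R}/\mathbb{Z})$.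
   Context: All functions are real-valued. $S := \frac{(2\pi)^2}{q-2}$, $\| u \| := \left( \int_0^1 \left( (u')^2 + S u^2\right)dt \right)^{1/2}$, $\|u\|_q := \left(\int_0^1 |u|^q\,dt\right)^{1/q}$, and $\overline u := \int_0^1 u\,dt$. *)

(* Defs.v *)
From mathcomp Require Import all_boot all_order all_algebra.
From mathcomp Require Import all_classical all_reals all_analysis.

Set Implicit Arguments.
Unset Strict Implicit.
Unset Printing Implicit Defensive.

Import Order.TTheory GRing.Theory Num.Theory.
Import numFieldNormedType.Exports.

Local Open Scope classical_set_scope.
Local Open Scope ring_scope.

(* Functions on the circle R/Z are 1-periodic functions R -> R; integrals over
   the circle are integrals over [0, 1]. *)

Definition circle_int (R : realType) (f : R -> R) : R :=
  \int[@lebesgue_measure R]_(t in (`[0, 1] : set R)) f t.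

Definition circle_L2 (R : realType) (f : R -> R) : Prop :=
  [/\ periodic f (1 : R),
      measurable_fun (`[0, 1] : set R) f
    & (@lebesgue_measure R).-integrable (`[0, 1] : set R) (fun t => (f t ^+ 2)%:E)].

Definition circle_test (R : realType) (phi : R -> R) : Prop :=
  periodic phi (1 : R) /\ forall (n : nat) (t : R), derivable (derive1n n phi) t 1.

(* u belongs to H^1(R/Z) and du is (a representative of) its weak derivative.
   As du is determined by u up to a null set, the norm below, which takes du as
   an argument, depends on u only. *)
Definition H1 (R : realType) (u du : R -> R) : Prop :=
  [/\ circle_L2 u,
      circle_L2 du
    & forall phi : R -> R, circle_test phi ->
        circle_int (fun t => u t * derive1 phi t) =
        - circle_int (fun t => du t * phi t)].

(* Elements of H^1 are taken up to null sets, hence so is constancy. *)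
Definition nonconstant (R : realType) (u : R -> R) : Prop :=
  ~ exists c : R, {ae @lebesgue_measure R, forall t, u t = c}.

Definition Sconst (R : realType) (q : R) : R := (2 * pi) ^+ 2 / (q - 2).

Definition H1norm (R : realType) (q : R) (u du : R -> R) : R :=
  Num.sqrt (circle_int (fun t => du t ^+ 2 + Sconst q * u t ^+ 2)).

Definition Lqnorm (R : realType) (q : R) (u : R -> R) : R :=
  circle_int (fun t => `|u t| `^ q) `^ q^-1.

(* The mean-free part; if H1 u du then also H1 (osc u) du. *)
Definition osc (R : realType) (u : R -> R) : R -> R :=
  fun t => u t - circle_int u.

Definition deficit (R : realType) (q : R) (u du : R -> R) : R :=
  H1norm q u du ^+ 2 - Sconst q * Lqnorm q u ^+ 2.

Definition quotient4 (R : realType) (q : R) (u du : R -> R) : R :=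
  H1norm q u du ^+ 2 * deficit q u du / H1norm q (osc u) du ^+ 4.

Definition ueps (R : realType) (q eps : R) : R -> R :=
  fun t => 1 + eps * cos (2 * pi * t)
           + eps ^+ 2 * ((q - 1) / 12) * cos (4 * pi * t).

(* Main.v *)
Require Import Defs.
From mathcomp Require Import all_boot all_order all_algebra.
From mathcomp Require Import all_classical all_reals all_analysis.
From mathcomp Require Import measurable_realfun ring lra.

Set Implicit Arguments.
Unset Strict Implicit.
Unset Printing Implicit Defensive.

Import Order.TTheory GRing.Theory Num.Theory.
Import numFieldNormedType.Exports.

Local Open Scope classical_set_scope.
Local Open Scope ring_scope.

(** The test function is [1 + w], where [w] is a polynomial in [cos (2 pi t)]
    with coefficients that are polynomials in [e]. The means of the powers of the
    cosine over a period follow from the recursion [momentSS], so the quadratic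
    norms ([energy_ueps]) and the means of [w], ..., [w ^+ 4] ([weps_moments]) are
    explicit polynomials in [e].

    The L^q norm needs two expansions of a power [(1 + x) `^ p] with remainder
    [O(x ^+ n)], both given by [powR1D_taylor]. With [p = q], [n = 5] and [x = w],
    it gives the integral of [u `^ q] up to [O(e ^+ 5)] ([Lq_integral_taylor]).
    With [p = 2 / q], [n = 3] and [x] equal to that integral minus [1], which is
    [O(e ^+ 2)], it gives the square of the L^q norm up to [o(e ^+ 4)]. The terms
    of order [e ^+ 2] cancel in the deficit, and the terms of order [e ^+ 4] give
    the limit in [deficit_ratio_cvg]; the coefficient [(q - 1) / 12] in the test
    function is the one that minimizes this limit. Division by the square of
    the squared norm of the mean-free part, of order [e ^+ 2], gives the limit of
    the quotient.

    The quotient is invariant under scaling, so normalized test functions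
    along [e = 1 / n.+1] show that the constant in the asymptotic lower bound
    cannot be increased. If the inequality held with a power [alpha < 4], then on
    the test functions the quotient times the norm of the mean-free part to the
    power [4 - alpha] would be bounded below by a positive constant, whereas it
    tends to [0]. *)

Lemma cvg_pow (R : realType) (T : Type) (F : set_system T) (f : T -> R) (l : R)
  (n : nat) : Filter F -> f x @[x --> F] --> l -> f x ^+ n @[x --> F] --> l ^+ n.
Proof.
move=> FF fl; apply: (@cvg_comp _ _ _ f (fun y : R => y ^+ n) F (nbhs l)) => //.
exact: exprn_continuous.
Qed.

Lemma is_derive_pow (R : realType) (f : R -> R) (x df : R) (n : nat) :
  is_derive x 1 f df ->
  is_derive x 1 (fun y => f y ^+ n.+1) (n.+1%:R * f x ^+ n * df).
Proof. by move=> /is_deriveX -/(_ n.+1); rewrite exprfctE. Qed.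

(** * Integrals of continuous functions over the circle *)

Lemma continuous_integrable01 (R : realType) (f : R -> R) : continuous f ->
  (@lebesgue_measure R).-integrable (`[0, 1] : set R) (EFin \o f).
Proof.
move=> cf; apply: continuous_compact_integrable; first exact: segment_compact.
exact: continuous_subspaceT.
Qed.

Lemma circle_intD (R : realType) (f g : R -> R) : continuous f -> continuous g ->
  circle_int (fun t => f t + g t) = circle_int f + circle_int g.
Proof.
by move=> cf cg; apply: RintegralD => //; exact: continuous_integrable01.
Qed.

Lemma circle_intZ (R : realType) (f : R -> R) (a : R) : continuous f ->
  circle_int (fun t => a * f t) = a * circle_int f.
Proof. by move=> cf; apply: RintegralZl => //; exact: continuous_integrable01. Qed.

Lemma circle_int_cst (R : realType) (a : R) : circle_int (fun=> a) = a.
Proof.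
rewrite /circle_int Rintegral_cst//= lebesgue_measure_itv/= lte_fin ltr01.
by rewrite oppr0 adde0 mulr1.
Qed.

Lemma circle_int_dist_le (R : realType) (f g : R -> R) (C : R) :
  continuous f -> continuous g -> (forall t, `|f t - g t| <= C) ->
  `|circle_int f - circle_int g| <= C.
Proof.
move=> cf cg fgC.
have cfg : continuous (fun t => f t - g t).
  by move=> t; apply: cvgB; [exact: cf|exact: cg].
have cn : continuous (fun t => `|f t - g t|).
  by move=> t; apply: cvg_norm; exact: cfg.
rewrite -[circle_int f - _]RintegralB//; try exact: continuous_integrable01.
apply: (le_trans (le_normr_Rintegral _ _)) => //; first exact: continuous_integrable01.
rewrite -[leRHS](@circle_int_cst R); apply: le_Rintegral => //.
- exact: continuous_integrable01.
- by apply: continuous_integrable01 => t; exact: cvg_cst.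
Qed.

Lemma is_derive_continuous (R : realType) (f df : R -> R) :
  (forall t : R, is_derive t 1 f (df t)) -> continuous f.
Proof.
move=> dF t; apply: differentiable_continuous; apply/derivable1_diffP.
exact: (@ex_derive _ _ _ _ _ _ _ (dF t)).
Qed.

(** The fundamental theorem of calculus on one period. *)
Lemma circle_int_FTC (R : realType) (F f : R -> R) :
  (forall t : R, is_derive t 1 F (f t)) -> continuous f ->
  circle_int f = F 1 - F 0.
Proof.
move=> dF cf.
have cF := is_derive_continuous dF.
rewrite /circle_int /Rintegral (@continuous_FTC2 R f F)//.
- exact: continuous_subspaceT.
- split.
  + by move=> t _; exact: (@ex_derive _ _ _ _ _ _ _ (dF t)).
  + by apply: cvg_at_right_filter; exact: cF.
  + by apply: cvg_at_left_filter; exact: cF.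
- by move=> t _; rewrite derive1E (@derive_val _ _ _ _ _ _ _ (dF t)).
Qed.

(** * Moments of the cosine *)

(** The cosine and sine of period [1]. *)
Definition circle_cos (R : realType) (t : R) : R := cos (2 * pi * t).
Definition circle_sin (R : realType) (t : R) : R := sin (2 * pi * t).

Lemma is_derive_circle_cos (R : realType) (t : R) :
  is_derive t 1 (@circle_cos R) (- (2 * pi) * circle_sin t).
Proof.
have d1 : is_derive t 1 (fun x : R => 2 * pi * x) (2 * pi).
  by apply: is_derive_eq; rewrite /GRing.scale /= mulr1.
have := is_derive1_comp (is_derive_cos (2 * pi * t)) d1.
by move=> h; apply: (is_derive_eq h); rewrite /circle_sin /GRing.scale /=; ring.
Qed.

Lemma is_derive_circle_sin (R : realType) (t : R) :
  is_derive t 1 (@circle_sin R) (2 * pi * circle_cos t).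
Proof.
have d1 : is_derive t 1 (fun x : R => 2 * pi * x) (2 * pi).
  by apply: is_derive_eq; rewrite /GRing.scale /= mulr1.
have := is_derive1_comp (is_derive_sin (2 * pi * t)) d1.
by move=> h; apply: (is_derive_eq h); rewrite /circle_cos /GRing.scale /=; ring.
Qed.

Lemma continuous_circle_cos (R : realType) : continuous (@circle_cos R).
Proof. exact: (is_derive_continuous (@is_derive_circle_cos R)). Qed.

Lemma continuous_circle_sin (R : realType) : continuous (@circle_sin R).
Proof. exact: (is_derive_continuous (@is_derive_circle_sin R)). Qed.

Lemma circle_sin_sqr (R : realType) (t : R) : circle_sin t ^+ 2 = 1 - circle_cos t ^+ 2.
Proof.
rewrite /circle_sin /circle_cos; move: (2 * pi * t) => x.
by rewrite -(cos2Dsin2 x); ring.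
Qed.

Lemma circle_sin0 (R : realType) : circle_sin (0 : R) = 0.
Proof. by rewrite /circle_sin mulr0 sin0. Qed.

Lemma circle_sin1 (R : realType) : circle_sin (1 : R) = 0.
Proof. by rewrite /circle_sin mulr1 mulrC mulr_natr sin2pi. Qed.

(** The mean of the [n]-th power of the cosine over one period. *)
Definition moment (R : realType) (n : nat) : R :=
  circle_int (fun t : R => circle_cos t ^+ n).

Lemma continuous_circle_cosX (R : realType) (n : nat) :
  continuous (fun t : R => circle_cos t ^+ n).
Proof. by move=> t; apply: cvg_pow; exact: continuous_circle_cos. Qed.

(** Integrating the derivative of [circle_cos ^+ n.+1 * circle_sin] over one
    period gives a two-step recursion for the moments. *)
Lemma momentSS (R : realType) (n : nat) :
  n.+2%:R * moment R n.+2 = n.+1%:R * moment R n.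
Proof.
have pi0 : 2 * pi != 0 :> R by rewrite mulf_neq0// gt_eqF ?pi_gt0.
pose f (t : R) := 2 * pi * (n.+2%:R * circle_cos t ^+ n.+2)
   + 2 * pi * (- n.+1%:R * circle_cos t ^+ n).
have cZ (a : R) m : continuous (fun t : R => a * circle_cos t ^+ m).
  by move=> t; apply: cvgM; [exact: cvg_cst|exact: continuous_circle_cosX].
have cZZ (b a : R) m : continuous (fun t : R => b * (a * circle_cos t ^+ m)).
  by move=> t; apply: cvgM; [exact: cvg_cst|exact: cZ].
have dF (t : R) : is_derive t 1 (fun t : R => circle_cos t ^+ n.+1 * circle_sin t) (f t).
  have dc := is_derive_pow n (is_derive_circle_cos t).
  have ds := is_derive_circle_sin t.
  apply: is_derive_eq; rewrite /f -![_ *: _]/(_ * _) !exprS.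
  rewrite [X in _ + X](_ : _ =
    - (2 * pi) * n.+1%:R * circle_cos t ^+ n * circle_sin t ^+ 2); last by ring.
  by rewrite circle_sin_sqr -[n.+2%:R]natr1; ring.
have cf : continuous f by move=> t; apply: cvgD; exact: cZZ.
have := circle_int_FTC dF cf; rewrite circle_sin0 circle_sin1 !mulr0 subrr.
rewrite circle_intD// ?circle_intZ//; try exact: continuous_circle_cosX;
  try exact: cZ; try exact: cZZ.
rewrite -mulrDr => /eqP; rewrite mulf_eq0 (negbTE pi0)/= mulNr subr_eq0.
by move=> /eqP.
Qed.

Lemma moment0 (R : realType) : moment R 0 = 1.
Proof.
rewrite /moment; under [X in circle_int X]eq_fun do rewrite expr0.
exact: circle_int_cst.
Qed.

Lemma moment1 (R : realType) : moment R 1 = 0.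
Proof.
have pi0 : 2 * pi != 0 :> R by rewrite mulf_neq0// gt_eqF ?pi_gt0.
have cf : continuous (fun t : R => 2 * pi * circle_cos t).
  by move=> t; apply: cvgM; [exact: cvg_cst|exact: continuous_circle_cos].
have := circle_int_FTC (@is_derive_circle_sin R) cf.
rewrite circle_sin0 circle_sin1 subrr circle_intZ; last exact: continuous_circle_cos.
by move=> /eqP; rewrite mulf_eq0 (negbTE pi0) => /eqP.
Qed.

Lemma continuous_horner_rec (R : realType) (s : seq R) :
  continuous (horner_rec s).
Proof.
elim: s => [|a s IH] t /=; first exact: cvg_cst.
apply: cvgD; last exact: cvg_cst.
by apply: cvgM; [exact: IH|exact: cvg_id].
Qed.

(** The sum [s`_0 * moment n + s`_1 * moment n.+1 + ...]. It is a fixpoint so that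
    it unfolds on a concrete list. *)
Fixpoint moment_sum (R : realType) (n : nat) (s : seq R) : R :=
  if s is a :: s' then a * moment R n + moment_sum n.+1 s' else 0.

Lemma circle_int_horner_shift (R : realType) (s : seq R) (n : nat) :
  circle_int (fun t => circle_cos t ^+ n * horner_rec s (circle_cos t)) = moment_sum n s.
Proof.
elim: s n => [|a s IH] n /=.
  by under [X in circle_int X]eq_fun do rewrite mulr0; rewrite circle_int_cst.
have c1 : continuous (fun t : R => circle_cos t ^+ n.+1 * horner_rec s (circle_cos t)).
  move=> t; apply: cvgM; first exact: continuous_circle_cosX.
  apply: (@continuous_comp _ _ _ (@circle_cos R) (horner_rec s)).
    exact: continuous_circle_cos.
  exact: continuous_horner_rec.
rewrite -IH -circle_intZ; last exact: continuous_circle_cosX.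
rewrite addrC -circle_intD//; last first.
  by move=> t; apply: cvgM; [exact: cvg_cst|exact: continuous_circle_cosX].
by congr circle_int; apply/funext => t; rewrite exprS; ring.
Qed.

(** Integration of an explicit polynomial in the cosine: it suffices to exhibit
    the list of its coefficients, constant term first. *)
Lemma circle_int_horner (R : realType) (s : seq R) (f : R -> R) :
  (forall t, f t = horner_rec s (circle_cos t)) -> circle_int f = moment_sum 0 s.
Proof.
move=> fs; rewrite -circle_int_horner_shift; congr circle_int; apply/funext => t.
by rewrite fs expr0 mul1r.
Qed.

Lemma momentE (R : realType) :
  (moment R 0 = 1) * (moment R 1 = 0) * (moment R 2 = 1 / 2) *
  (moment R 3 = 0) * (moment R 4 = 3 / 8) * (moment R 5 = 0) *
  (moment R 6 = 5 / 16) * (moment R 7 = 0) * (moment R 8 = 35 / 128).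
Proof.
have m0 := moment0 R; have m1 := moment1 R.
have m2 := momentSS R 0; have m3 := momentSS R 1; have m4 := momentSS R 2.
have m5 := momentSS R 3; have m6 := momentSS R 4; have m7 := momentSS R 5.
have m8 := momentSS R 6.
by do !split => //; lra.
Qed.

(** * The binomial series with remainder *)

(** The generalized binomial coefficient [p (p - 1) ... (p - n + 1) / n!] with a
    real upper argument. The recursion lowers [p], as differentiation does. *)
Fixpoint gen_binom (R : realType) (p : R) (n : nat) : R :=
  if n is m.+1 then p / n%:R * gen_binom (p - 1) m else 1.

(** The Taylor polynomial of degree less than [n] of [(1 + x) `^ p] at [0]. *)
Definition binomial_sum (R : realType) (p : R) (n : nat) (x : R) : R :=
  \sum_(j < n) gen_binom p j * x ^+ j.

Lemma is_derive_binomial_sum (R : realType) (p : R) (n : nat) (x : R) :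
  is_derive x 1 (binomial_sum p n.+1) (p * binomial_sum (p - 1) n x).
Proof.
elim: n => [|n IH].
  rewrite {2}/binomial_sum big_ord0 mulr0.
  have -> : binomial_sum p 1 = cst (gen_binom p 0).
    by apply/funext => y; rewrite /binomial_sum big_ord1 expr0 mulr1.
  exact: is_derive_cst.
have -> : binomial_sum p n.+2 =
    (fun y => binomial_sum p n.+1 y + gen_binom p n.+1 * y ^+ n.+1).
  by apply/funext => y; rewrite /binomial_sum big_ord_recr.
have dX := is_derive_pow n (is_derive_id x 1).
apply: is_derive_eq.
rewrite [in RHS]/binomial_sum big_ord_recr /= /GRing.scale /= -mulr_natl mulrDr; congr (_ + _).
by field; rewrite addrC natr1 pnatr_eq0.
Qed.

Lemma binomial_sum0 (R : realType) (p : R) (n : nat) : binomial_sum p n.+1 0 = 1.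
Proof.
rewrite /binomial_sum big_ord_recl expr0 mulr1 big1 ?addr0//= => i _.
by rewrite exprS mul0r mulr0.
Qed.

Lemma is_derive_powR1D (R : realType) (p x : R) : 0 < 1 + x ->
  is_derive x 1 (fun y => (1 + y) `^ p) (p * (1 + x) `^ (p - 1)).
Proof.
move=> x0.
have d1 : is_derive x 1 (fun y : R => 1 + y) 1.
  have h := is_deriveD (is_derive_cst (1 : R) x (1 : R)) (is_derive_id x (1 : R)).
  by apply: (is_derive_eq h); rewrite add0r.
have h := @is_derive1_comp R (fun y : R => y `^ p) (fun y : R => 1 + y) x _ _
  (is_derive1_powR p x0) d1.
by apply: (is_derive_eq h); rewrite mulr1.
Qed.

(** Integration of a bound: if [f 0 = 0] and [|f' x| <= M |x| ^ n], then
    [|f x| <= M |x| ^ n.+1]. *)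
Lemma MVT0_bound (R : realType) (f df : R -> R) (r M : R) (n : nat) :
  0 <= M -> (forall x : R, `|x| <= r -> is_derive x 1 f (df x)) -> f 0 = 0 ->
  (forall x, `|x| <= r -> `|df x| <= M * `|x| ^+ n) ->
  forall x, `|x| <= r -> `|f x| <= M * `|x| ^+ n.+1.
Proof.
move=> M0 fdf f0 dfM x xr.
have cf (a b : R) : (forall y, y \in `[a, b] -> `|y| <= r) ->
    {within `[a, b], continuous f}.
  move=> abr; apply: continuous_in_subspaceT => y yab.
  apply: differentiable_continuous; apply/derivable1_diffP.
  by apply: (@ex_derive _ _ _ _ _ _ _ (fdf y _)); apply: abr; rewrite inE in yab.
have key (y : R) : `|y| <= `|x| -> f x = df y * x -> `|f x| <= M * `|x| ^+ n.+1.
  move=> yx ->; rewrite normrM exprSr mulrA ler_wpM2r//.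
  apply: (le_trans (dfM _ (le_trans yx xr))).
  by rewrite ler_wpM2l// lerXn2r// nnegrE.
have [x0|x0|->] := ltgtP x 0; last first.
- by rewrite f0 !normr0 exprS mul0r mulr0.
- have abr y : y \in `[0, x] -> `|y| <= `|x|.
    by rewrite in_itv/= => /andP[? ?]; rewrite !ger0_norm// ltW.
  have [y|y|y yx] := @MVT _ f df 0 x x0.
  + by move=> /subset_itv_oo_cc /abr yx; apply: fdf; exact: le_trans xr.
  + by apply: cf => z /abr zx; exact: le_trans xr.
  + rewrite f0 !subr0; apply: key; apply: abr; exact: subset_itv_oo_cc.
- have abr y : y \in `[x, 0] -> `|y| <= `|x|.
    by rewrite in_itv/= => /andP[? ?]; rewrite !ler0_norm ?lerN2// ltW.
  have [y|y|y yx] := @MVT _ f df x 0 x0.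
  + by move=> /subset_itv_oo_cc /abr yx; apply: fdf; exact: le_trans xr.
  + by apply: cf => z /abr zx; exact: le_trans xr.
  + rewrite f0 !sub0r mulrN => /oppr_inj.
    apply: key; apply: abr; exact: subset_itv_oo_cc.
Qed.

(** The remainder of the binomial series is [O(x ^ n)]. Differentiating it gives
    [p] times the remainder of order [n - 1] for the exponent [p - 1], hence an
    induction on [n] for all [p] at once. *)
Lemma powR1D_taylor (R : realType) (p : R) (n : nat) :
  exists2 C : R, 0 <= C & forall x : R, `|x| <= 1 / 2 ->
    `|(1 + x) `^ p - binomial_sum p n x| <= C * `|x| ^+ n.
Proof.
elim: n p => [|n IH] p.
  exists ((3 / 2) `^ p + (1 / 2) `^ p).
    by rewrite addr_ge0// powR_ge0.
  move=> x; rewrite ler_norml => /andP[x1 x2].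
  rewrite /binomial_sum big_ord0 subr0 expr0 mulr1 ger0_norm ?powR_ge0//.
  have [p0|p0] := leP 0 p.
    rewrite (le_trans _ (_ : (3 / 2) `^ p <= _)) ?lerDl ?powR_ge0//.
    by rewrite ge0_ler_powR ?nnegrE//; lra.
  rewrite (le_trans _ (_ : (1 / 2) `^ p <= _)) ?lerDr ?powR_ge0//.
  rewrite -[p]opprK !(powRN _ (- p)) lef_pV2 ?posrE ?powR_gt0//; try lra.
  by rewrite ge0_ler_powR ?nnegrE//; lra.
have [C C0 CP] := IH (p - 1).
exists (`|p| * C); first by rewrite mulr_ge0.
have x1 (x : R) : `|x| <= 1 / 2 -> 0 < 1 + x.
  by rewrite ler_norml => /andP[x1 x2]; lra.
apply: (@MVT0_bound _ _ (fun x => p * ((1 + x) `^ (p - 1) - binomial_sum (p - 1) n x))).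
- by rewrite mulr_ge0.
- move=> x xr; have d1 := is_derive_powR1D p (x1 x xr).
  have d2 := is_derive_binomial_sum p n x.
  by apply: is_derive_eq; rewrite mulrBr.
- by rewrite addr0 powR1 binomial_sum0 subrr.
- by move=> x xr; rewrite normrM -mulrA ler_wpM2l// CP.
Qed.

(** * Continuously differentiable functions in the Sobolev space *)

(** A continuous function which is constant up to a null set is constant, as a
    nonempty open set has positive measure. *)
Lemma nonconstant_continuous (R : realType) (u : R -> R) (a b : R) :
  continuous u -> u a != u b -> nonconstant u.
Proof.
move=> cu uab [c uc].
have [x ux] : exists x, u x != c.
  have [ua|ua] := eqVneq (u a) c; last by exists a.
  by exists b; rewrite -ua eq_sym.
have /nbhs_ballP[r /= r0 rux] : \forall y \near x, u y != c.
  apply: (cu x [set z | z != c]).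
  by apply: open_nbhs_nbhs; split; [exact: open_neq|].
have : (@lebesgue_measure R).-negligible (ball x r).
  by apply: negligibleS uc => y /rux /eqP.
move=> neg; have : @lebesgue_measure R (ball x r) = 0%E.
  by apply: measure_negligible => //; exact: measurable_ball.
rewrite lebesgue_measure_ball ?ltW// => /eqP; rewrite eqe mulrn_eq0/=.
by rewrite gt_eqF.
Qed.

Lemma H1_C1 (R : realType) (u du : R -> R) :
  periodic u (1 : R) -> periodic du (1 : R) ->
  (forall t : R, is_derive t 1 u (du t)) -> continuous du -> H1 u du.
Proof.
move=> pu pdu dF cdu.
have cu := is_derive_continuous dF.
have L2 f : periodic f (1 : R) -> continuous f -> circle_L2 f.
  move=> pf cf; split => //.
    by apply: measurable_funTS; exact: continuous_measurable_fun.
  by apply: continuous_integrable01 => t; apply: cvg_pow; exact: cf.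
split; [exact: L2|exact: L2|move=> phi [pphi dphi]].
have d0 (t : R) : is_derive t 1 phi (derive1 phi t).
  by apply: DeriveDef; [exact: (dphi 0%N t)|rewrite derive1E].
have c0 := is_derive_continuous d0.
have c1 : continuous (derive1 phi).
  move=> t; apply: differentiable_continuous; apply/derivable1_diffP.
  exact: (dphi 1%N t).
have cM (f g : R -> R) : continuous f -> continuous g -> continuous (fun t => f t * g t).
  by move=> cf cg t; apply: cvgM; [exact: cf|exact: cg].
have dM (t : R) : is_derive t 1 (fun t => u t * phi t)
    (u t * derive1 phi t + du t * phi t).
  have := dF t; have := d0 t => d0t dFt.
  by apply: is_derive_eq; rewrite /GRing.scale /= [phi t * _]mulrC.
have cD : continuous (fun t => u t * derive1 phi t + du t * phi t).
  by move=> t; apply: cvgD; exact: cM.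
have := circle_int_FTC dM cD; rewrite circle_intD; try exact: cM.
have -> : u 1 = u 0 by rewrite -(pu 0) add0r.
have -> : phi 1 = phi 0 by rewrite -(pphi 0) add0r.
by rewrite subrr => /eqP; rewrite addr_eq0 => /eqP.
Qed.

(** * The test function *)

(** The coefficient of [e ^+ 2 * cos (4 * pi * t)] in the test function. *)
Definition kappa (R : realType) (q : R) : R := (q - 1) / 12.

(** The deviation of the test function from its mean [1], as a polynomial in the
    cosine of [2 * pi * t]. *)
Definition weps (R : realType) (q e t : R) : R :=
  - (e ^+ 2 * kappa q) + e * circle_cos t
  + 2 * (e ^+ 2 * kappa q) * circle_cos t ^+ 2.

Lemma uepsE (R : realType) (q e t : R) : ueps q e t = 1 + weps q e t.
Proof.
rewrite /ueps /weps -/(kappa q) -/(circle_cos t).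
rewrite (_ : 4 * pi * t = (2 * pi * t) *+ 2); last by ring.
by rewrite cos_mulr2n -/(circle_cos t); ring.
Qed.

(** The derivative of the test function. *)
Definition dueps (R : realType) (q e t : R) : R :=
  - (2 * pi) * e * circle_sin t * (1 + 4 * (e * kappa q) * circle_cos t).

Lemma is_derive_ueps (R : realType) (q e t : R) :
  is_derive t 1 (ueps q e) (dueps q e t).
Proof.
have dc := is_derive_circle_cos t; have ds := is_derive_circle_sin t.
have d2 := is_derive_pow 1 dc.
rewrite (_ : ueps q e = (fun t => 1 + (- (e ^+ 2 * kappa q) + e * circle_cos t +
    2 * (e ^+ 2 * kappa q) * circle_cos t ^+ 2))); last first.
  by apply/funext => s; exact: uepsE.
by apply: is_derive_eq; rewrite /dueps /GRing.scale /=; ring.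
Qed.

Lemma derive1_ueps (R : realType) (q e : R) : derive1 (ueps q e) = dueps q e.
Proof.
apply/funext => t; rewrite derive1E; have h := is_derive_ueps q e t.
exact: derive_val.
Qed.

Lemma circle_cosD1 (R : realType) (t : R) : circle_cos (t + 1) = circle_cos t.
Proof.
by rewrite /circle_cos mulrDr mulr1 -[in RHS]cosD2pi; congr cos; ring.
Qed.

Lemma circle_sinD1 (R : realType) (t : R) : circle_sin (t + 1) = circle_sin t.
Proof.
by rewrite /circle_sin mulrDr mulr1 -[in RHS]sinD2pi; congr sin; ring.
Qed.

Lemma continuous_ueps (R : realType) (q e : R) : continuous (ueps q e).
Proof. exact: (is_derive_continuous (is_derive_ueps q e)). Qed.

Lemma continuous_dueps (R : realType) (q e : R) : continuous (dueps q e).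
Proof.
move=> t; apply: cvgM.
  by apply: cvgM; [exact: cvg_cst|exact: continuous_circle_sin].
apply: cvgD; first exact: cvg_cst.
by apply: cvgM; [exact: cvg_cst|exact: continuous_circle_cos].
Qed.

Lemma H1_ueps (R : realType) (q e a : R) :
  H1 (fun t => a * ueps q e t) (fun t => a * dueps q e t).
Proof.
apply: H1_C1.
- by move=> t; rewrite !uepsE /weps circle_cosD1.
- by move=> t; rewrite /dueps circle_cosD1 circle_sinD1.
- move=> t; have h := is_derive_ueps q e t; apply: is_derive_eq.
  by rewrite /GRing.scale /=; ring.
- by move=> t; apply: cvgM; [exact: cvg_cst|exact: continuous_dueps].
Qed.

Lemma nonconstant_ueps (R : realType) (q e a : R) : e != 0 -> a != 0 ->
  nonconstant (fun t => a * ueps q e t).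
Proof.
move=> e0 a0; apply: (@nonconstant_continuous _ _ 0 (1 / 2)).
  by move=> t; apply: cvgM; [exact: cvg_cst|exact: continuous_ueps].
have c0 : circle_cos (0 : R) = 1 by rewrite /circle_cos mulr0 cos0.
have c1 : circle_cos (1 / 2 : R) = -1.
  by rewrite /circle_cos (_ : 2 * pi * (1 / 2) = pi) ?cospi//; field.
rewrite (inj_eq (mulfI a0)) !uepsE /weps c0 c1 -subr_eq0.
rewrite (_ : _ - _ = 2 * e); first by rewrite mulf_neq0.
by ring.
Qed.

Lemma circle_int_ueps (R : realType) (q e : R) : circle_int (ueps q e) = 1.
Proof.
rewrite (@circle_int_horner _ [:: 1 - e ^+ 2 * kappa q; e; 2 * (e ^+ 2 * kappa q)]).
  by rewrite /= !momentE; field.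
by move=> t; rewrite uepsE /weps /=; ring.
Qed.

(** The coefficient lists below collect the powers of the cosine in the
    integrand, with [circle_sin ^+ 2] replaced by [1 - circle_cos ^+ 2]. *)
Lemma energy_ueps (R : realType) (q e s a : R) :
  circle_int (fun t => dueps q e t ^+ 2 + s * (ueps q e t - a) ^+ 2) =
  (2 * pi) ^+ 2 * (e ^+ 2 / 2 + 2 * e ^+ 4 * kappa q ^+ 2) +
  s * ((1 - a) ^+ 2 + e ^+ 2 / 2 + e ^+ 4 * kappa q ^+ 2 / 2).
Proof.
set P := (2 * pi) ^+ 2; set k := kappa q.
pose b := 1 - a - e ^+ 2 * k.
rewrite (@circle_int_horner _ [::
  P * e ^+ 2 + s * b ^+ 2;
  P * e ^+ 2 * (8 * e * k) + s * (2 * b * e);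
  P * e ^+ 2 * (16 * e ^+ 2 * k ^+ 2 - 1) + s * (e ^+ 2 + 4 * b * e ^+ 2 * k);
  - (P * e ^+ 2 * (8 * e * k)) + s * (4 * e ^+ 3 * k);
  - (P * e ^+ 2 * (16 * e ^+ 2 * k ^+ 2)) + s * (4 * e ^+ 4 * k ^+ 2)]).
  by rewrite /= !momentE /b; field.
move=> t; rewrite uepsE /weps /dueps -/k /=.
rewrite (_ : (_ * _ * _ * _) ^+ 2 = P * e ^+ 2 * circle_sin t ^+ 2 *
  (1 + 4 * (e * k) * circle_cos t) ^+ 2); last by rewrite /P; ring.
by rewrite circle_sin_sqr /b; ring.
Qed.

Lemma weps_moments (R : realType) (q e : R) :
  [/\ circle_int (fun t => weps q e t) = 0,
   circle_int (fun t => weps q e t ^+ 2) = e ^+ 2 / 2 + e ^+ 4 * kappa q ^+ 2 / 2,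
   circle_int (fun t => weps q e t ^+ 3) = 3 / 4 * e ^+ 4 * kappa q &
   circle_int (fun t => weps q e t ^+ 4) = 3 / 8 * e ^+ 4 +
     3 / 2 * e ^+ 6 * kappa q ^+ 2 + 3 / 8 * e ^+ 8 * kappa q ^+ 4].
Proof.
rewrite /weps; set k := kappa q.
pose B := - (e ^+ 2 * k); pose D := 2 * (e ^+ 2 * k).
split.
- rewrite (@circle_int_horner _ [:: B; e; D]); last by move=> t; rewrite /B /D /=; ring.
  by rewrite /= !momentE /B /D; field.
- rewrite (@circle_int_horner _ [:: B ^+ 2; 2 * e * B; e ^+ 2 + 2 * B * D;
    2 * e * D; D ^+ 2]); last by move=> t; rewrite /B /D /=; ring.
  by rewrite /= !momentE /B /D; field.
- rewrite (@circle_int_horner _ [:: B ^+ 3; 3 * e * B ^+ 2;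
    3 * e ^+ 2 * B + 3 * B ^+ 2 * D; e ^+ 3 + 6 * e * B * D;
    3 * e ^+ 2 * D + 3 * B * D ^+ 2; 3 * e * D ^+ 2; D ^+ 3]); last first.
    by move=> t; rewrite /B /D /=; ring.
  by rewrite /= !momentE /B /D; field.
- rewrite (@circle_int_horner _ [:: B ^+ 4; 4 * e * B ^+ 3;
    6 * e ^+ 2 * B ^+ 2 + 4 * B ^+ 3 * D; 4 * e ^+ 3 * B + 12 * e * B ^+ 2 * D;
    e ^+ 4 + 12 * e ^+ 2 * B * D + 6 * B ^+ 2 * D ^+ 2;
    4 * e ^+ 3 * D + 12 * e * B * D ^+ 2; 6 * e ^+ 2 * D ^+ 2 + 4 * B * D ^+ 3;
    4 * e * D ^+ 3; D ^+ 4]); last by move=> t; rewrite /B /D /=; ring.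
  by rewrite /= !momentE /B /D; field.
Qed.

(** * Expansion of the L^q norm *)

Lemma circle_int_binomial_sum (R : realType) (p : R) (n : nat) (w : R -> R) :
  continuous w -> circle_int (fun t => binomial_sum p n (w t)) =
    \sum_(j < n) gen_binom p j * circle_int (fun t => w t ^+ j).
Proof.
move=> cw.
have cj (a : R) j : continuous (fun t => a * w t ^+ j).
  by move=> t; apply: cvgM; [exact: cvg_cst|apply: cvg_pow; exact: cw].
have cb m : continuous (fun t => binomial_sum p m (w t)).
  elim: m => [|m IH].
    rewrite (_ : (fun _ => _) = cst 0) => [t|]; first exact: cvg_cst.
    by apply/funext => t; rewrite /binomial_sum big_ord0.
  rewrite (_ : (fun _ => _) = fun t => binomial_sum p m (w t) + gen_binom p m * w t ^+ m).
    by move=> t; apply: cvgD; [exact: IH|exact: cj].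
  by apply/funext => t; rewrite /binomial_sum big_ord_recr.
elim: n => [|n IH].
  rewrite big_ord0 -[RHS](@circle_int_cst R); congr circle_int.
  by apply/funext => t; rewrite /binomial_sum big_ord0.
rewrite big_ord_recr/= -IH -circle_intZ; last first.
  by move=> t; apply: cvg_pow; exact: cw.
rewrite -circle_intD//; congr circle_int.
by apply/funext => t; rewrite /binomial_sum big_ord_recr.
Qed.

Lemma continuous_weps (R : realType) (q e : R) : continuous (weps q e).
Proof.
move=> t; apply: cvgD; first apply: cvgD; first exact: cvg_cst.
  by apply: cvgM; [exact: cvg_cst|exact: continuous_circle_cos].
by apply: cvgM; [exact: cvg_cst|exact: continuous_circle_cosX].
Qed.

Lemma weps_bound (R : realType) (q e t : R) : 1 < q -> 0 < e -> e < 1 ->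
  `|weps q e t| <= (1 + 3 * kappa q) * e.
Proof.
move=> q1 e0 e1; rewrite /weps.
have k0 : 0 <= kappa q by rewrite divr_ge0//; lra.
have c1 : `|circle_cos t| <= 1 by exact: cos_max.
have ee : e ^+ 2 <= e by rewrite expr2 ger_pMr// ltW.
have eek : e ^+ 2 * kappa q <= e * kappa q by exact: ler_wpM2r.
have eek0 : 0 <= e ^+ 2 * kappa q by rewrite mulr_ge0// exprn_ge0// ltW.
have h1 : `|e * circle_cos t| <= e.
  by rewrite normrM gtr0_norm// ler_piMr// ltW.
have h2 : `|2 * (e ^+ 2 * kappa q) * circle_cos t ^+ 2| <= 2 * (e ^+ 2 * kappa q).
  have h0 : 0 <= 2 * (e ^+ 2 * kappa q) by rewrite mulr_ge0.
  by rewrite normrM (ger0_norm h0) ler_piMr// normrX exprn_ile1.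
apply: (le_trans (ler_normD _ _)).
apply: (le_trans (lerD (ler_normD _ _) h2)).
by rewrite normrN (ger0_norm eek0); lra.
Qed.

(** The [q]-th power of the L^q norm of the test function. *)
Definition Lq_integral (R : realType) (q e : R) : R :=
  circle_int (fun t => `|ueps q e t| `^ q).

(** The integral of the Taylor polynomial of degree [4] of [(1 + w) `^ q], for
    [w] the deviation of the test function, is
    [1 + q * (q - 1) / 4 * e ^+ 2 + Lq_coef4 q e * e ^+ 4]. *)
Definition Lq_coef4 (R : realType) (q e : R) : R :=
  gen_binom q 2 * kappa q ^+ 2 / 2 + gen_binom q 3 * (3 / 4 * kappa q) +
  gen_binom q 4 * (3 / 8 + 3 / 2 * kappa q ^+ 2 * e ^+ 2 + 3 / 8 * kappa q ^+ 4 * e ^+ 4).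

Lemma Lq_integral_taylor (R : realType) (q : R) : 2 < q ->
  exists2 C : R, 0 <= C & \forall e \near (0 : R)^'+,
    `|Lq_integral q e - (1 + q * (q - 1) / 4 * e ^+ 2 + Lq_coef4 q e * e ^+ 4)|
      <= C * e ^+ 5.
Proof.
move=> q2.
have k0 : 0 <= kappa q by rewrite divr_ge0//; lra.
(* The remainder of order 5 is needed, as the [e ^+ 4] term must be exact. *)
have [C C0 CP] := powR1D_taylor q 5.
pose M := 1 + 3 * kappa q.
have M0 : 0 < M by rewrite /M; lra.
exists (C * M ^+ 5); first by rewrite mulr_ge0// exprn_ge0// ltW.
near=> e.
have e0 : 0 < e by near: e; exact: nbhs_right_gt.
have e1 : e < 1 by near: e; exact: nbhs_right_lt.
have eM : M * e <= 1 / 2.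
  rewrite mulrC -ler_pdivlMr//; near: e; apply: nbhs_right_le.
  by rewrite divr_gt0.
have wM t : `|weps q e t| <= M * e by apply: weps_bound => //; lra.
have w2 t : `|weps q e t| <= 1 / 2 by exact: le_trans (wM t) eM.
have uw t : `|ueps q e t| = 1 + weps q e t.
  rewrite uepsE ger0_norm//.
  by have := w2 t; rewrite ler_norml => /andP[]; lra.
have cw := @continuous_weps R q e.
have cp : continuous (fun t => (1 + weps q e t) `^ q).
  move=> t; apply: (@continuous_comp _ _ _ (weps q e) (fun y => (1 + y) `^ q)).
    exact: cw.
  apply: differentiable_continuous; apply/derivable1_diffP.
  apply: (@ex_derive _ _ _ _ _ _ _ (is_derive_powR1D q _)).
  by have := w2 t; rewrite ler_norml => /andP[]; lra.
have cb : continuous (fun t => binomial_sum q 5 (weps q e t)).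
  move=> t; apply: (@continuous_comp _ _ _ (weps q e) (binomial_sum q 5)).
    exact: cw.
  exact: (is_derive_continuous (is_derive_binomial_sum q 4)).
have -> : Lq_integral q e = circle_int (fun t => (1 + weps q e t) `^ q).
  by rewrite /Lq_integral; congr circle_int; apply/funext => t; rewrite uw.
have -> : 1 + q * (q - 1) / 4 * e ^+ 2 + Lq_coef4 q e * e ^+ 4 =
    circle_int (fun t => binomial_sum q 5 (weps q e t)).
  rewrite circle_int_binomial_sum// !big_ord_recr big_ord0 /=.
  have -> : circle_int (fun t => weps q e t ^+ 0) = 1.
    by under [X in circle_int X]eq_fun do rewrite expr0; rewrite circle_int_cst.
  have [w1 w2' w3 w4] := weps_moments q e.
  have -> : circle_int (fun t => weps q e t ^+ 1) = 0 by exact: w1.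
  by rewrite w2' w3 w4 /Lq_coef4 /=; field.
apply: circle_int_dist_le => // t.
apply: (le_trans (CP _ (w2 t))).
by rewrite -mulrA ler_wpM2l// -exprMn lerXn2r// nnegrE// (le_trans _ (wM t)).
Unshelve. all: by end_near. Qed.

Lemma cvg_dist_le (R : realType) (T : Type) (F : set_system T) (f g h : T -> R)
    (l : R) : Filter F ->
  (\forall x \near F, `|f x - g x| <= h x) -> h x @[x --> F] --> (0 : R) ->
  g x @[x --> F] --> l -> f x @[x --> F] --> l.
Proof.
move=> FF fgh h0 gl.
have fg0 : (f x - g x) @[x --> F] --> (0 : R).
  apply/norm_cvg0P; apply: (squeeze_cvgr _ (cvg_cst (0 : R)) h0).
  by apply: filterS fgh => x ->; rewrite normr_ge0.
rewrite -[l]add0r; apply: cvg_trans (cvgD fg0 gl).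
by apply: near_eq_cvg; near=> x; rewrite /= subrK.
Unshelve. all: by end_near. Qed.

Lemma cvg0r_pow (R : realType) (n : nat) : e ^+ n.+1 @[e --> (0 : R)^'+] --> (0 : R).
Proof.
have : e ^+ n.+1 @[e --> (0 : R)^'+] --> (0 : R) ^+ n.+1.
  apply: cvg_pow; apply: cvg_at_right_filter; exact: cvg_id.
by rewrite expr0n.
Qed.

Lemma Lq_coef4_cvg (R : realType) (q : R) :
  Lq_coef4 q e @[e --> 0^'+] --> Lq_coef4 q 0.
Proof.
have h n (a : R) : a * e ^+ n @[e --> 0^'+] --> a * 0 ^+ n.
  apply: cvgM; first exact: cvg_cst.
  by apply: cvg_pow; apply: cvg_at_right_filter; exact: cvg_id.
apply: cvgD; first exact: cvg_cst.
apply: cvgM; first exact: cvg_cst.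
apply: cvgD; last exact: h.
apply: cvgD; last exact: h.
exact: cvg_cst.
Qed.

(** The rescaled remainders of the expansion of [Lq_integral], at orders
    [e ^+ 4] and [e ^+ 2]. *)
Definition Lq_ratio4 (R : realType) (q e : R) : R :=
  (Lq_integral q e - 1 - q * (q - 1) / 4 * e ^+ 2) / e ^+ 4.

Lemma Lq_ratio4_cvg (R : realType) (q : R) : 2 < q ->
  Lq_ratio4 q e @[e --> 0^'+] --> Lq_coef4 q 0.
Proof.
move=> q2; have [C C0 CP] := Lq_integral_taylor q2.
apply: (@cvg_dist_le _ _ _ _ (Lq_coef4 q) (fun e => C * e ^+ 1)).
- near=> e.
  have e0 : 0 < e by near: e; exact: nbhs_right_gt.
  have e4 : 0 < e ^+ 4 by exact: exprn_gt0.
  have -> : Lq_ratio4 q e - Lq_coef4 q e = (Lq_integral q e -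
      (1 + q * (q - 1) / 4 * e ^+ 2 + Lq_coef4 q e * e ^+ 4)) / e ^+ 4.
    by rewrite /Lq_ratio4; field; rewrite gt_eqF.
  rewrite normrM normfV (gtr0_norm e4) ler_pdivrMr//.
  have -> : C * e ^+ 1 * e ^+ 4 = C * e ^+ 5 by ring.
  by near: e.
- by rewrite -[X in _ --> X](mulr0 C); apply: cvgM; [exact: cvg_cst|exact: cvg0r_pow].
- exact: Lq_coef4_cvg.
Unshelve. all: by end_near. Qed.

Definition Lq_ratio2 (R : realType) (q e : R) : R :=
  q * (q - 1) / 4 + e ^+ 2 * Lq_ratio4 q e.

Lemma Lq_ratio2_cvg (R : realType) (q : R) : 2 < q ->
  Lq_ratio2 q e @[e --> 0^'+] --> q * (q - 1) / 4.
Proof.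
move=> q2; rewrite -[X in _ --> X]addr0 -[X in _ --> _ + X](mul0r (Lq_coef4 q 0)).
apply: cvgD; first exact: cvg_cst.
by apply: cvgM; [exact: cvg0r_pow|exact: Lq_ratio4_cvg].
Qed.

Lemma Lq_integral_ratio2 (R : realType) (q e : R) : 0 < e ->
  Lq_integral q e = 1 + e ^+ 2 * Lq_ratio2 q e.
Proof. by move=> e0; rewrite /Lq_ratio2 /Lq_ratio4; field; rewrite gt_eqF. Qed.

Lemma Lq_integral_cvg (R : realType) (q : R) : 2 < q ->
  Lq_integral q e @[e --> 0^'+] --> (1 : R).
Proof.
move=> q2.
have h : 1 + e ^+ 2 * Lq_ratio2 q e @[e --> 0^'+] --> (1 + 0 * (q * (q - 1) / 4) : R).
  apply: cvgD; first exact: cvg_cst.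
  by apply: cvgM; [exact: cvg0r_pow|exact: Lq_ratio2_cvg].
rewrite mul0r addr0 in h; apply: cvg_trans h; apply: near_eq_cvg; near=> e.
by rewrite -Lq_integral_ratio2//; near: e; exact: nbhs_right_gt.
Unshelve. all: by end_near. Qed.

(** * Limit of the rescaled deficit *)

(** The squared norm of the test function, divided by [Sconst q]. *)
Definition norm_ratio (R : realType) (q e : R) : R :=
  (q - 2) * (e ^+ 2 / 2 + 2 * e ^+ 4 * kappa q ^+ 2) +
  (1 + e ^+ 2 / 2 + e ^+ 4 * kappa q ^+ 2 / 2).

(** The squared norm of its mean-free part, divided by [Sconst q * e ^+ 2]. *)
Definition osc_ratio (R : realType) (q e : R) : R :=
  (q - 2) * (1 / 2 + 2 * e ^+ 2 * kappa q ^+ 2) +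
  (1 / 2 + e ^+ 2 * kappa q ^+ 2 / 2).

(** The deficit of the test function, divided by [Sconst q * e ^+ 4]. *)
Definition deficit_ratio (R : realType) (q e : R) : R :=
  (norm_ratio q e - Lq_integral q e `^ (2 / q)) / e ^+ 4.

(** The [e ^+ 2] terms of the squared norm and of the squared L^q norm cancel;
    the limit is the difference of their [e ^+ 4] terms. *)
Lemma deficit_ratio_cvg (R : realType) (q : R) : 2 < q ->
  deficit_ratio q e @[e --> 0^'+] --> (q - 1) * (q - 2) * (q + 2) / 48.
Proof.
move=> q2; (* With [x := Lq_integral q e - 1 = O(e ^+ 2)], the remainder [O(x ^+ 3)] of
   [(1 + x) `^ (2 / q)] is negligible against [e ^+ 4]. *)
have [C C0 CP] := powR1D_taylor (2 / q) 3.
have q0 : q != 0 by rewrite gt_eqF//; lra.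
pose g e := (2 * (q - 2) + 1 / 2) * kappa q ^+ 2 - 2 / q * Lq_ratio4 q e
  - gen_binom (2 / q) 2 * Lq_ratio2 q e ^+ 2.
apply: (@cvg_dist_le _ _ _ _ g (fun e => C * `|Lq_ratio2 q e| ^+ 3 * e ^+ 2)).
- near=> e.
  have e0 : 0 < e by near: e; exact: nbhs_right_gt.
  have e4 : 0 < e ^+ 4 by exact: exprn_gt0.
  pose x := e ^+ 2 * Lq_ratio2 q e.
  have x2 : `|x| <= 1 / 2.
    have -> : x = Lq_integral q e - 1 by rewrite /x Lq_integral_ratio2//; ring.
    rewrite distrC; near: e.
    by move/cvgrPdist_le: (Lq_integral_cvg q2); apply; rewrite divr_gt0.
  have -> : deficit_ratio q e - g e =
      - ((1 + x) `^ (2 / q) - binomial_sum (2 / q) 3 x) / e ^+ 4.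
    rewrite /deficit_ratio Lq_integral_ratio2// -/x; set P := _ `^ _.
    rewrite /binomial_sum !big_ord_recr big_ord0 /= /g /norm_ratio /x /Lq_ratio2.
    by rewrite /=; field; rewrite q0 gt_eqF.
  rewrite normrM normrN normfV (gtr0_norm e4) ler_pdivrMr//.
  apply: (le_trans (CP _ x2)).
  rewrite /x normrM exprMn normrX (gtr0_norm e0) le_eqVlt; apply/orP; left.
  by apply/eqP; ring.
- rewrite -[X in _ --> X](mulr0 (C * `|q * (q - 1) / 4| ^+ 3)).
  apply: cvgM; last exact: cvg0r_pow.
  apply: cvgM; first exact: cvg_cst.
  by apply: cvg_pow; apply: cvg_norm; exact: Lq_ratio2_cvg.
- have -> : (q - 1) * (q - 2) * (q + 2) / 48 = (2 * (q - 2) + 1 / 2) * kappa q ^+ 2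
      - 2 / q * Lq_coef4 q 0 - gen_binom (2 / q) 2 * (q * (q - 1) / 4) ^+ 2.
    by rewrite /Lq_coef4 /kappa /=; field.
  apply: cvgB; first apply: cvgB; first exact: cvg_cst.
    by apply: cvgM; [exact: cvg_cst|exact: Lq_ratio4_cvg].
  apply: cvgM; first exact: cvg_cst.
  by apply: cvg_pow; exact: Lq_ratio2_cvg.
Unshelve. all: by end_near. Qed.

Lemma norm_ratio_cvg (R : realType) (q : R) : norm_ratio q e @[e --> 0^'+] --> (1 : R).
Proof.
have -> : 1 = (q - 2) * (0 / 2 + 2 * 0 * kappa q ^+ 2) +
  (1 + 0 / 2 + 0 * kappa q ^+ 2 / 2) by field.
have h n (a : R) : a * e ^+ n.+1 @[e --> 0^'+] --> (a * 0 : R).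
  by apply: cvgM; [exact: cvg_cst|exact: cvg0r_pow].
have hd n (a : R) : e ^+ n.+1 * a @[e --> 0^'+] --> (0 * a : R).
  by apply: cvgM; [exact: cvg0r_pow|exact: cvg_cst].
apply: cvgD; first (apply: cvgM; first exact: cvg_cst); apply: cvgD.
- exact: hd.
- by apply: cvgM; [exact: h|exact: cvg_cst].
- by apply: cvgD; [exact: cvg_cst|exact: hd].
- by apply: cvgM; [exact: hd|exact: cvg_cst].
Qed.

Lemma osc_ratio_cvg (R : realType) (q : R) : osc_ratio q e @[e --> 0^'+] --> (q - 1) / 2.
Proof.
have -> : (q - 1) / 2 = (q - 2) * (1 / 2 + 2 * 0 * kappa q ^+ 2) +
  (1 / 2 + 0 * kappa q ^+ 2 / 2) by field.
have h n (a : R) : a * e ^+ n.+1 @[e --> 0^'+] --> (a * 0 : R).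
  by apply: cvgM; [exact: cvg_cst|exact: cvg0r_pow].
have hd n (a : R) : e ^+ n.+1 * a @[e --> 0^'+] --> (0 * a : R).
  by apply: cvgM; [exact: cvg0r_pow|exact: cvg_cst].
apply: cvgD; first (apply: cvgM; first exact: cvg_cst); apply: cvgD.
- exact: cvg_cst.
- by apply: cvgM; [exact: h|exact: cvg_cst].
- exact: cvg_cst.
- by apply: cvgM; [exact: hd|exact: cvg_cst].
Qed.

(** * Norms and quotient of the multiples of the test function *)

Lemma Sconst_gt0 (R : realType) (q : R) : 2 < q -> 0 < Sconst q.
Proof.
by move=> q2; rewrite divr_gt0 ?subr_gt0// exprn_gt0// mulr_gt0// pi_gt0.
Qed.

Lemma H1norm_sqr (R : realType) (q : R) (u du : R -> R) : 2 < q ->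
  H1norm q u du ^+ 2 = circle_int (fun t => du t ^+ 2 + Sconst q * u t ^+ 2).
Proof.
move=> q2; rewrite sqr_sqrtr//; apply: Rintegral_ge0 => t _.
by rewrite addr_ge0 ?sqr_ge0// mulr_ge0 ?sqr_ge0// ltW// Sconst_gt0.
Qed.

Lemma energy_scaled_ueps (R : realType) (q e a b : R) : 2 < q ->
  H1norm q (fun t => a * (ueps q e t - b)) (fun t => a * dueps q e t) ^+ 2 =
  a ^+ 2 * Sconst q * ((q - 2) * (e ^+ 2 / 2 + 2 * e ^+ 4 * kappa q ^+ 2) +
    ((1 - b) ^+ 2 + e ^+ 2 / 2 + e ^+ 4 * kappa q ^+ 2 / 2)).
Proof.
move=> q2; rewrite H1norm_sqr//.
have -> : (fun t => (a * dueps q e t) ^+ 2 + Sconst q * (a * (ueps q e t - b)) ^+ 2) =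
    (fun t => a ^+ 2 * (dueps q e t ^+ 2 + Sconst q * (ueps q e t - b) ^+ 2)).
  by apply/funext => t; ring.
rewrite circle_intZ ?energy_ueps.
  by rewrite /Sconst; field; rewrite subr_eq0 gt_eqF.
move=> t; apply: cvgD; first by apply: cvg_pow; exact: continuous_dueps.
apply: cvgM; first exact: cvg_cst.
by apply: cvg_pow; apply: cvgB; [exact: continuous_ueps|exact: cvg_cst].
Qed.

Lemma H1norm_ueps (R : realType) (q e a : R) : 2 < q ->
  H1norm q (fun t => a * ueps q e t) (fun t => a * dueps q e t) ^+ 2 =
  a ^+ 2 * Sconst q * norm_ratio q e.
Proof.
move=> q2.
have E : (fun t => a * ueps q e t) = (fun t => a * (ueps q e t - 0)).
  by apply/funext => t; rewrite subr0.
by rewrite E energy_scaled_ueps// subr0 expr1n.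
Qed.

Lemma osc_ueps (R : realType) (q e a : R) :
  osc (fun t => a * ueps q e t) = (fun t => a * (ueps q e t - 1)).
Proof.
apply/funext => t; rewrite /osc circle_intZ; last exact: continuous_ueps.
by rewrite circle_int_ueps mulrBr.
Qed.

Lemma H1norm_osc_ueps (R : realType) (q e a : R) : 2 < q ->
  H1norm q (osc (fun t => a * ueps q e t)) (fun t => a * dueps q e t) ^+ 2 =
  a ^+ 2 * Sconst q * (e ^+ 2 * osc_ratio q e).
Proof.
by move=> q2; rewrite osc_ueps energy_scaled_ueps// /osc_ratio; ring.
Qed.

(** No integrability is needed: for an infinite integral both sides are [0]. *)
Lemma circle_intZ_ge0 (R : realType) (f : R -> R) (a : R) :
  measurable_fun (`[0, 1] : set R) f -> (forall t, 0 <= f t) -> 0 < a ->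
  circle_int (fun t => a * f t) = a * circle_int f.
Proof.
move=> mf f0 a0; rewrite /circle_int /Rintegral.
under eq_integral do rewrite EFinM.
rewrite ge0_integralZl_EFin//; last 3 first.
- by move=> t _; rewrite lee_fin.
- exact/measurable_EFinP.
- exact: ltW.
case: (\int[_]_(_ in _) _)%E => [r//| |] /=.
- by rewrite mulry gtr0_sg// mul1e mulr0.
- by rewrite mulrNy gtr0_sg// mul1e mulr0.
Qed.

Lemma Lqnorm_ueps (R : realType) (q e a : R) : 2 < q -> 0 < a ->
  Lqnorm q (fun t => a * ueps q e t) = a * Lq_integral q e `^ q^-1.
Proof.
move=> q2 a0; have q0 : q != 0 by rewrite gt_eqF//; lra.
have J0 : 0 <= Lq_integral q e.
  by apply: Rintegral_ge0 => t _; exact: powR_ge0.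
rewrite /Lqnorm.
have -> : (fun t => `|a * ueps q e t| `^ q) = (fun t => a `^ q * `|ueps q e t| `^ q).
  by apply/funext => t; rewrite normrM gtr0_norm// powRM// ltW.
rewrite circle_intZ_ge0 ?powR_gt0//.
- by rewrite powRM ?powR_ge0// -powRrM mulfV// powRr1// ltW.
- apply: measurable_funTS; apply: (measurableT_comp (measurable_powR q)).
  apply: continuous_measurable_fun => t; apply: cvg_norm.
  exact: continuous_ueps.
Qed.

Lemma osc_ratio_gt0 (R : realType) (q e : R) : 2 < q -> 0 < osc_ratio q e.
Proof.
move=> q2; have h : 0 <= e ^+ 2 * kappa q ^+ 2 by rewrite mulr_ge0 ?sqr_ge0.
rewrite /osc_ratio ltr_wpDl//; last by rewrite -mulrA; lra.
by rewrite mulr_ge0//; lra.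
Qed.

Lemma norm_ratio_ge1 (R : realType) (q e : R) : 2 < q -> 1 <= norm_ratio q e.
Proof.
move=> q2; have -> : norm_ratio q e = 1 + e ^+ 2 * osc_ratio q e.
  by rewrite /norm_ratio /osc_ratio; ring.
by rewrite lerDl mulr_ge0 ?sqr_ge0// ltW// osc_ratio_gt0.
Qed.

(** The quotient is invariant under multiplication of the function by [a]. *)
Lemma quotient4_ueps (R : realType) (q e a : R) : 2 < q -> 0 < a -> 0 < e ->
  quotient4 q (fun t => a * ueps q e t) (fun t => a * dueps q e t) =
  norm_ratio q e * deficit_ratio q e / osc_ratio q e ^+ 2.
Proof.
move=> q2 a0 e0; rewrite /quotient4 /deficit.
have -> (x : R) : x ^+ 4 = (x ^+ 2) ^+ 2 by rewrite -exprM.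
rewrite H1norm_osc_ueps// H1norm_ueps// Lqnorm_ueps// /deficit_ratio.
have -> : Lq_integral q e `^ (2 / q) = (Lq_integral q e `^ q^-1) ^+ 2.
  by rewrite mulrC powRrM powR_mulrn// powR_ge0.
have S0 := Sconst_gt0 q2; have o0 := osc_ratio_gt0 e q2.
by field; rewrite !gt_eqF.
Qed.

Lemma quotient4_cvg (R : realType) (q : R) : 2 < q ->
  norm_ratio q e * deficit_ratio q e / osc_ratio q e ^+ 2 @[e --> 0^'+] -->
  (q + 2) * (q - 2) / (12 * (q - 1)).
Proof.
move=> q2.
have -> : (q + 2) * (q - 2) / (12 * (q - 1)) =
    1 * ((q - 1) * (q - 2) * (q + 2) / 48) / ((q - 1) / 2) ^+ 2.
  by field; rewrite subr_eq0 gt_eqF//; lra.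
apply: cvgM.
  by apply: cvgM; [exact: norm_ratio_cvg|exact: deficit_ratio_cvg].
apply: cvgV; first by rewrite expf_neq0// mulf_neq0 ?invr_eq0// subr_eq0 gt_eqF//; lra.
by apply: cvg_pow; exact: osc_ratio_cvg.
Qed.

Lemma Lq_integral_powR_cvg (R : realType) (q p : R) : 2 < q ->
  Lq_integral q e `^ p @[e --> 0^'+] --> (1 : R).
Proof.
move=> q2; have -> : 1 = 1 `^ p :> R by rewrite powR1.
apply: (@cvg_comp _ _ _ (Lq_integral q) (fun x => x `^ p) _ (nbhs (1 : R))).
  exact: Lq_integral_cvg.
suff : {for 1, continuous (fun x : R => x `^ p)} by [].
apply: differentiable_continuous; apply/derivable1_diffP.
exact: (@ex_derive _ _ _ _ _ _ _ (is_derive1_powR p ltr01)).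
Qed.

Lemma mul1_fun (R : realType) (f : R -> R) : (fun t => 1 * f t) = f.
Proof. by apply/funext => t; rewrite mul1r. Qed.

(** The inequality with power [alpha], where [hp = h `^ (2 - alpha)] and
    [oa = o `^ alpha], in terms of the quotient [h ^+ 2 * d / o ^+ 4]. *)
Lemma quotient_lower_bound (R : realType) (c h d o hp oa : R) : 0 < o -> 0 < oa ->
  c * hp * oa <= d -> c * (h ^+ 2 * hp) <= h ^+ 2 * d / o ^+ 4 * (o ^+ 4 / oa).
Proof.
move=> o0 oa0 cd.
have -> : h ^+ 2 * d / o ^+ 4 * (o ^+ 4 / oa) = h ^+ 2 * d / oa.
  by field; rewrite !gt_eqF.
rewrite ler_pdivlMr//.
have -> : c * (h ^+ 2 * hp) * oa = h ^+ 2 * (c * hp * oa) by ring.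
by rewrite ler_wpM2l// sqr_ge0.
Qed.

Lemma cvg_harmonic_at_right (R : realType) (f : R -> R) (l : R) :
  f x @[x --> 0^'+] --> l -> f (harmonic n) @[n --> \oo] --> l.
Proof.
move=> /cvg_at_rightP; apply; split; last exact: cvg_harmonic.
by move=> n; exact: harmonic_gt0.
Qed.

(** * Sharpness of the constant and of the power *)

Theorem mainTheorem4 (R : realType) (q : R) (hq : 2 < q) :
  let K : R := (q + 2) * (q - 2) / (12 * (q - 1)) in
  [/\ quotient4 q (ueps q eps) (derive1 (ueps q eps)) @[eps --> 0^'+] --> K,
      forall C : R, K < C ->
        ~ (forall u du : nat -> R -> R,
             (forall n, H1 (u n) (du n)) ->
             (forall n, nonconstant (u n)) ->
             (forall n, H1norm q (u n) (du n) ^+ 2 = Sconst q) ->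
             Lqnorm q (u n) @[n --> \oo] --> (1 : R) ->
             (C%:E <= limn_einf (fun n => (quotient4 q (u n) (du n))%:E))%E)
    & forall alpha : R, alpha < 4 ->
        ~ (exists2 c : R, 0 < c &
             forall u du : R -> R, H1 u du -> nonconstant u ->
               c * H1norm q u du `^ (2 - alpha)
                 * H1norm q (osc u) du `^ alpha <= deficit q u du)].
Proof.
move=> K; have Kcvg := quotient4_cvg hq; rewrite -/K in Kcvg.
have S0 := Sconst_gt0 hq.
split.
- apply: cvg_trans Kcvg; apply: near_eq_cvg; near=> e.
  have e0 : 0 < e by near: e; exact: nbhs_right_gt.
  have := quotient4_ueps hq ltr01 e0.
  by rewrite (mul1_fun (ueps q e)) (mul1_fun (dueps q e)) derive1_ueps => ->.
- move=> C KC abs.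
  (* The test functions with [e = 1 / n.+1], normalized to squared norm
     [Sconst q], form an admissible sequence whose quotients tend to [K]. *)
  pose a e := (Num.sqrt (norm_ratio q e))^-1.
  have n0 e : 0 < norm_ratio q e by exact: lt_le_trans (norm_ratio_ge1 e hq).
  have a0 e : 0 < a e by rewrite invr_gt0 sqrtr_gt0.
  have a1 : a e @[e --> 0^'+] --> (1 : R).
    have -> : 1 = (Num.sqrt 1)^-1 :> R by rewrite sqrtr1 invr1.
    apply: cvgV; first by rewrite sqrtr1.
    apply: (@cvg_comp _ _ _ (norm_ratio q) Num.sqrt _ (nbhs (1 : R))).
      exact: norm_ratio_cvg.
    exact: sqrt_continuous.
  pose u n t := a (harmonic n) * ueps q (harmonic n) t.
  pose du n t := a (harmonic n) * dueps q (harmonic n) t.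
  have limL : Lqnorm q (u n) @[n --> \oo] --> (1 : R).
    have -> : (fun n => Lqnorm q (u n)) = (fun n =>
        a (harmonic n) * Lq_integral q (harmonic n) `^ q^-1).
      by apply/funext => n; exact: Lqnorm_ueps.
    apply: (@cvg_harmonic_at_right _ (fun e => a e * Lq_integral q e `^ q^-1)).
    by rewrite -[X in _ --> X]mulr1; apply: cvgM => //; exact: Lq_integral_powR_cvg.
  have : (C%:E <= limn_einf (fun n => (quotient4 q (u n) (du n))%:E))%E.
    apply: abs => // n; first exact: H1_ueps.
      by apply: nonconstant_ueps; rewrite gt_eqF// harmonic_gt0.
    rewrite H1norm_ueps// exprVn sqr_sqrtr; last exact: ltW.
    by field; rewrite gt_eqF.
  have Kn : quotient4 q (u n) (du n) @[n --> \oo] --> K.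
    have -> : (fun n => quotient4 q (u n) (du n)) = (fun n =>
        norm_ratio q (harmonic n) * deficit_ratio q (harmonic n)
          / osc_ratio q (harmonic n) ^+ 2).
      by apply/funext => n; apply: quotient4_ueps => //; exact: harmonic_gt0.
    exact: (cvg_harmonic_at_right Kcvg).
  have /cvg_limn_einf_sup[-> _] :
      (quotient4 q (u n) (du n))%:E @[n --> \oo] --> K%:E.
    by apply: cvg_EFin => //; exact: nearW.
  by rewrite lee_fin leNgt KC.
- move=> alpha alpha4 [c c0 abs].
  (* With [Q] the quotient and [o] the norm of the mean-free part, the assumed
     inequality implies [c * m `^ s <= Q * o `^ s], whose right side tends to
     [K * 0]. *)
  pose s := 4 - alpha; have s0 : 0 < s by rewrite subr_gt0.
  pose m := Num.sqrt (Sconst q).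
  have m0 : 0 < m by rewrite sqrtr_gt0.
  pose Q e := norm_ratio q e * deficit_ratio q e / osc_ratio q e ^+ 2.
  pose o e := H1norm q (osc (ueps q e)) (dueps q e).
  have o2 e : o e ^+ 2 = Sconst q * (e ^+ 2 * osc_ratio q e).
    rewrite /o; have := @H1norm_osc_ueps _ q e 1 hq.
    by rewrite (mul1_fun (ueps q e)) (mul1_fun (dueps q e)) expr1n mul1r.
  have o0 e : 0 < e -> 0 < o e.
    move=> e0; rewrite lt_def sqrtr_ge0 andbT -sqrf_eq0 o2.
    rewrite gt_eqF// mulr_gt0//; apply: mulr_gt0; first exact: exprn_gt0.
    exact: osc_ratio_gt0.
  have ineq : \forall e \near 0^'+, c * m `^ s <= Q e * o e `^ s.
    near=> e.
    have e0 : 0 < e by near: e; exact: nbhs_right_gt.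
    have oe0 := o0 _ e0.
    pose h := H1norm q (ueps q e) (dueps q e).
    have h2 : h ^+ 2 = Sconst q * norm_ratio q e.
      rewrite /h; have := @H1norm_ueps _ q e 1 hq.
      by rewrite (mul1_fun (ueps q e)) (mul1_fun (dueps q e)) expr1n mul1r.
    have mh : m <= h.
      rewrite -(@ler_pXn2r _ 2) ?nnegrE ?sqrtr_ge0// h2.
      rewrite sqr_sqrtr; last exact: ltW.
      by rewrite ler_peMr; [|exact: ltW|exact: norm_ratio_ge1].
    have h0 : 0 < h by exact: lt_le_trans mh.
    have Qh : Q e = h ^+ 2 * deficit q (ueps q e) (dueps q e) / o e ^+ 4.
      by rewrite /Q -(quotient4_ueps hq ltr01 e0) (mul1_fun (ueps q e)) (mul1_fun (dueps q e)).
    have := abs (ueps q e) (dueps q e).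
    have := @H1_ueps _ q e 1; have := @nonconstant_ueps _ q e 1.
    rewrite (mul1_fun (ueps q e)) (mul1_fun (dueps q e)).
    move=> /(_ (lt0r_neq0 e0) (oner_neq0 _)) nc H1u.
    move=> /(_ H1u nc); rewrite -/h -/(o e) => ledef.
    have hs : m `^ s <= h `^ s.
      by rewrite ge0_ler_powR ?nnegrE// ltW.
    apply: (le_trans (ler_wpM2l (ltW c0) hs)).
    have -> : o e `^ s = o e ^+ 4 / o e `^ alpha.
      by rewrite /s powRB ?powR_mulrn// ?ltW// (gt_eqF oe0) implybT.
    have -> : h `^ s = h ^+ 2 * h `^ (2 - alpha).
      rewrite -powR_mulrn ?ltW// -powRD ?(gt_eqF h0) ?implybT//.
      by rewrite /s; congr (_ `^ _); ring.
    have oa0 : 0 < o e `^ alpha by exact: powR_gt0.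
    by rewrite Qh; exact: quotient_lower_bound.
  have olim : o e @[e --> 0^'+] --> (0 : R)^'+.
    have o0lim : o e @[e --> 0^'+] --> (0 : R).
      have -> : o = fun e => Num.sqrt (Sconst q * (e ^+ 2 * osc_ratio q e)).
        by apply/funext => e; rewrite -o2 sqrtr_sqr ger0_norm// sqrtr_ge0.
      have -> : nbhs (0 : R) = nbhs (Num.sqrt (Sconst q * (0 * ((q - 1) / 2)))).
        by rewrite mul0r mulr0 sqrtr0.
      apply: (@cvg_comp _ _ _ _ Num.sqrt _ (nbhs _)); last exact: sqrt_continuous.
      apply: cvgM; first exact: cvg_cst.
      by apply: cvgM; [exact: cvg0r_pow|exact: osc_ratio_cvg].
    move=> P /o0lim Po; apply: filterS2 (nbhs_right_gt (0 : R)) Po => e e0 Po.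
    exact: Po (o0 _ e0).
  have lim0 : Q e * o e `^ s @[e --> 0^'+] --> (0 : R).
    rewrite -[X in _ --> X](mulr0 K); apply: cvgM; first exact: Kcvg.
    exact: (cvg_comp _ _ olim (powR_cvg0 s0)).
  have : c * m `^ s <= 0.
    rewrite -(cvg_lim _ lim0)//; apply: limr_ge ineq; apply/cvg_ex; by exists 0.
  by rewrite leNgt mulr_gt0// powR_gt0.
Unshelve. all: by end_near. Qed.
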